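(* Let $f\in C^1(\mathbb{R}^d,\mathbb{R})$ and assume: (A1) there is $L\ge0$ with $\|\nabla f(x)-\nabla f(y)\|\le L\|x-y\|$ for all $x,y\in\mathbb{R}^d$; (A2 and F2) $f$ has a minimizer $x^\star\in\arg\min_{\mathbb{R}^d}f$, and there are a Polish probability space $(\mathsf Z,\mathcal Z,\pi^Z)$ and $\eta\ge0$ such that one of the following holds: (a) there is $H:\mathbb{R}^d\times\mathsf Z\to\mathbb{R}^d$ such that for all $x$, $\int H(x,z)d\pi^Z(z)=\nabla f(x)$ and $\int\|H(x,z)-\nabla f(x)\|^2d\pi^Z(z)\le\eta$; and $f$ is convex; (b) there is $\tilde f:\mathbb{R}^d\times\mathsf Z\to\mathbb{R}$ such that for all $z$, $\tilde f(\cdot,z)$ is $C^1$ with $L$-Lipschitz gradient, $\int\tilde f(x,z)d\pi^Z(z)=f(x)$ and $\int\nabla\tilde f(x,z)d\pi^Z(z)=\nabla f(x)$ for all $x$, and there is a point $\bar x\in\mathbb{R}^d$ with $\int\|\nabla\tilde f(\bar x,z)\|^2d\pi^Z(z)\le\eta$ (set $H=\nabla\tilde f$); and for all $z\in\mathsf Z$, $\tilde f(\cdot,z)$ is convex. Let $\gamma,\alpha\in(0,1)$, let $(Z_n)_{n\in\mathbb{N}}$ be independent random variables with law $\pi^Z$, and let $(X_n)_{n\in\mathbb{N}}$ start from $X_0\in\mathbb{R}^d$ and satisfy $X_{n+1}=X_n-\gamma(n+1)^{-\alpha}H(X_n,Z_{n+1})$ for all $n\in\mathbb{N}$. Then there exists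 $C\ge0$ such that for any $N\ge1$, $$\mathbb{E}[\|\nabla f(X_N)\|^2]\le C\,\frac{(1+\log(N+1))^2}{(N+1)^{\alpha\wedge(1-\alpha)}}.$$
   Context: $\nabla\tilde f$ denotes the gradient in the first variable. $a\wedge b=\min(a,b)$. All functions are assumed measurable. *)

(* Defs.v *)
From HB Require Import structures.
From mathcomp Require Import all_boot all_order all_algebra finmap.
From mathcomp Require Import all_classical all_reals all_analysis.

Set Implicit Arguments.
Unset Strict Implicit.
Unset Printing Implicit Defensive.

Import Order.TTheory GRing.Theory Num.Theory.
Import numFieldTopology.Exports numFieldNormedType.Exports.

Local Open Scope classical_set_scope.
Local Open Scope ring_scope.

(* The library norm on 'rV[R]_d is the sup norm: it induces the usual topology
   (hence the usual notions of differentiability, continuity and Borel sets),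
   but the quantitative estimates are about the Euclidean norm. *)
Definition enorm (R : realType) (d : nat) (x : 'rV[R]_d) : R :=
  Num.sqrt (\sum_(i < d) x ord0 i ^+ 2).

Definition grad (R : realType) (d : nat) (f : 'rV[R]_d -> R) (x : 'rV[R]_d) :
    'rV[R]_d :=
  \row_(i < d) 'D_(delta_mx ord0 i) f x.

Definition is_C1 (R : realType) (d : nat) (f : 'rV[R]_d -> R) : Prop :=
  (forall x, differentiable f x) /\ continuous (grad f).

Definition grad_lipschitz (R : realType) (d : nat) (L : R)
    (f : 'rV[R]_d -> R) : Prop :=
  forall x y, enorm (grad f x - grad f y) <= L * enorm (x - y).

Definition convex_on_space (R : realType) (d : nat) (f : 'rV[R]_d -> R) : Prop :=
  convex_function [set: convex_lmodType 'rV[R]_d] f.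

Notation borel T := (g_sigma_algebraType (@open T)).

Definition polish_space (R : realType) (T : topologicalType) : Prop :=
  (exists2 D : set T, countable D & dense D) /\
  (exists rho : T -> T -> R,
    [/\ forall x y, rho x y = 0 <-> x = y,
        forall x y, rho x y = rho y x,
        forall x y z, rho x z <= rho x y + rho y z,
        forall x : T,
          nbhs x = filter_from [set e : R | 0 < e]
                     (fun e => [set y | rho x y < e]) &
        forall u : nat -> T,
          (forall e : R, 0 < e -> exists K : nat, forall m n : nat,
              (K <= m)%N -> (K <= n)%N -> rho (u m) (u n) < e) ->
          exists l : T, u @ \oo --> l]).

(* int g dmu = m for a vector-valued g, coordinate by coordinate; existence of
   the integral (integrability) is part of the assertion. *)
Definition has_integral (R : realType) (d : nat) (disp : measure_display)
    (T : measurableType disp) (mu : {measure set T -> \bar R})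
    (g : T -> 'rV[R]_d) (m : 'rV[R]_d) : Prop :=
  forall i : 'I_d,
    mu.-integrable [set: T] (fun z => (g z ord0 i)%:E) /\
    (\int[mu]_z (g z ord0 i)%:E)%E = (m ord0 i)%:E.

Definition mutually_independent (R : realType) (d d' : measure_display)
    (Omega : measurableType d) (T : measurableType d')
    (P : probability Omega R) (X : nat -> {RV P >-> T}) : Prop :=
  forall (J : {fset nat}) (A : nat -> set T),
    (forall i, i \in J -> measurable (A i)) ->
    P (\bigcap_(i in [set` J]) (X i @^-1` A i)) =
      (\prod_(i <- J) P (X i @^-1` A i))%E.

Definition bounded_variance_oracle (R : realType) (d : nat)
    (Z : ptopologicalType) (piZ : probability (borel Z) R) (eta : R)
    (f : 'rV[R]_d -> R) (H : 'rV[R]_d -> Z -> 'rV[R]_d) : Prop :=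
  [/\ forall x, has_integral piZ (H x) (grad f x),
      forall x,
        (\int[piZ]_z (enorm (H x z - grad f x) ^+ 2)%:E <= eta%:E)%E &
      convex_on_space f].

Definition convex_sample_oracle (R : realType) (d : nat)
    (Z : ptopologicalType) (piZ : probability (borel Z) R) (L eta : R)
    (f : 'rV[R]_d -> R) (H : 'rV[R]_d -> Z -> 'rV[R]_d) : Prop :=
  exists ft : 'rV[R]_d -> Z -> R,
    measurable_fun [set: borel 'rV[R]_d * borel Z]
      (fun p : borel 'rV[R]_d * borel Z => ft p.1 p.2) /\
    [/\ forall z, is_C1 (ft^~ z) /\ grad_lipschitz L (ft^~ z),
        forall x, piZ.-integrable [set: borel Z] (fun z => (ft x z)%:E) /\
          (\int[piZ]_z (ft x z)%:E)%E = (f x)%:E,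
        forall x, has_integral piZ (fun z => grad (ft^~ z) x) (grad f x),
        exists xbar,
          (\int[piZ]_z (enorm (grad (ft^~ z) xbar) ^+ 2)%:E <= eta%:E)%E &
        forall z, convex_on_space (ft^~ z)] /\
    (forall x z, H x z = grad (ft^~ z) x).

(* Main.v *)
Require Import Defs.
From HB Require Import structures.
From mathcomp Require Import all_boot all_order all_algebra finmap.
From mathcomp Require Import all_classical all_reals all_analysis.
From mathcomp Require Import measurable_realfun zify ring lra.

Set Implicit Arguments.
Unset Strict Implicit.
Unset Printing Implicit Defensive.

Import Order.TTheory GRing.Theory Num.Theory.
Import numFieldTopology.Exports numFieldNormedType.Exports.

Local Open Scope classical_set_scope.
Local Open Scope ring_scope.

(** Write [F n] for the expected gap [E (f (X n)) - min f].  A convex function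
    with [L]-Lipschitz gradient satisfies [|grad f x|^2 <= 4 L (f x - min f)]
    ([grad_le_gap]), so the theorem follows from the same rate for [F], which is
    a statement about the last iterate of stochastic gradient descent.

    The two sampling assumptions have a common consequence: [H x] is unbiased
    and [E |H x|^2 <= A (f x - min f) + B] ([growth_oracle]).  The second moment
    may thus be unbounded, but it is controlled by the very quantity under
    study.  Expand [|X (n+1) - Y|^2] for a point [Y] determined by the samples
    up to time [n].  The next sample is independent of these, so it can be
    integrated out first ([integral_past_next]), and the tangent inequality
    gives ([iterate_step]), with [g n] the step sizes,
      [E |X (n+1) - Y|^2 + 2 (g n) F n
         <= E |X n - Y|^2 + 2 (g n) (E f(Y) - min f) + (g n)^2 (A (F n) + B)].

    This is used for two choices of [Y].  With [Y] a minimizer, the terms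
    [(g n)^2 A (F n)] are absorbed by the left-hand side as soon as
    [A (g n) <= 1], and the weighted sum of the gaps is at most a constant plus
    [B] times the sum of the squared steps ([weighted_gap_sum]).  With
    [Y = X k], one compares the gap at time [k] with the average gap over
    [k..N].  Following Shamir and Zhang, let [k] run from the middle of [0..N]
    to its end.  Since the noise grows with the gap, the usual additive
    recursion between consecutive suffix averages becomes a multiplicative one
    for [A S + B], where [S] is the suffix average ([suffix_average_step]).  The
    product of the factors is at most [exp (2 A (g N) (1 + ln (N+1)))]; it stays
    bounded because [g N] is a negative power of [N+1], and the excess of the
    exponential over 1 costs one logarithm ([last_le_suffix_average]).  The
    average over the second half of [0..N] has the announced order, because its
    total weight is at least of order [(N+1)^(1 - alpha)] while the sum of the
    squared steps is at most of order
    [(1 + ln (N+1)) (N+1)^(max 0 (1 - 2 alpha))]. *)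

(** * Euclidean geometry and smooth convex functions *)

Definition dotp {R : realType} {d : nat} (u v : 'rV[R]_d) : R :=
  \sum_(i < d) u ord0 i * v ord0 i.

Section Euclidean.
Context {R : realType} {d : nat}.
Implicit Types (u v w : 'rV[R]_d) (a : R).

Lemma dotpC u v : dotp u v = dotp v u.
Proof. by apply: eq_bigr => i _; rewrite mulrC. Qed.

Lemma dotpDl u v w : dotp (u + v) w = dotp u w + dotp v w.
Proof. by rewrite -big_split; apply: eq_bigr => i _; rewrite !mxE mulrDl. Qed.

Lemma dotpZl a u w : dotp (a *: u) w = a * dotp u w.
Proof. by rewrite mulr_sumr; apply: eq_bigr => i _; rewrite !mxE mulrA. Qed.

Lemma dotpNl u w : dotp (- u) w = - dotp u w.
Proof. by rewrite -scaleN1r dotpZl mulN1r. Qed.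

Lemma dotpDr u v w : dotp w (u + v) = dotp w u + dotp w v.
Proof. by rewrite dotpC dotpDl !(dotpC w). Qed.

Lemma dotpZr a u w : dotp w (a *: u) = a * dotp w u.
Proof. by rewrite dotpC dotpZl dotpC. Qed.

Lemma dotpNr u w : dotp w (- u) = - dotp w u.
Proof. by rewrite dotpC dotpNl dotpC. Qed.

Definition dotpE := (dotpDl, dotpDr, dotpNl, dotpNr, dotpZl, dotpZr).

Lemma dotp_ge0 u : 0 <= dotp u u.
Proof. by apply: sumr_ge0 => i _; rewrite -expr2 sqr_ge0. Qed.

Lemma enorm_sqE u : enorm u ^+ 2 = dotp u u.
Proof.
rewrite /enorm sqr_sqrtr; last by apply: sumr_ge0 => i _; exact: sqr_ge0.
by apply: eq_bigr => i _; rewrite expr2.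
Qed.

Lemma enorm_ge0 u : 0 <= enorm u.
Proof. exact: sqrtr_ge0. Qed.

Lemma dotp0_eq0 u : dotp u u = 0 -> u = 0.
Proof.
move=> u0; apply/rowP => i; rewrite mxE; apply/eqP; rewrite -sqrf_eq0 expr2.
by rewrite (psumr_eq0P _ u0)// => j _; rewrite -expr2 sqr_ge0.
Qed.

Lemma dotp_derive (f : 'rV[R]_d -> R) x v :
  differentiable f x -> 'D_v f x = dotp (grad f x) v.
Proof.
move=> df; rewrite deriveE// {1}(row_sum_delta v) linear_sum.
by apply: eq_bigr => i _; rewrite linearZ /= mxE deriveE// mulrC.
Qed.

End Euclidean.

Section SmoothConvex.
Context {R : realType} {d : nat}.
Implicit Types (f : 'rV[R]_d -> R) (x y u : 'rV[R]_d).

(** Convexity along the segment from [x] to [y], divided by the parameter of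
    the segment, passes to the limit at [0+]. *)
Lemma convex_tangent f x y : differentiable f x -> convex_on_space f ->
  f x + dotp (grad f x) (y - x) <= f y.
Proof.
move=> df cf; rewrite -dotp_derive// -lerBrDl.
have /cvg_dnbhs_at_right := diff_derivable (v := y - x) df.
move=> H; apply: (cvgr_to_le H).
near=> t.
have t0 : 0 < t by near: t; exact: nbhs_right_gt.
have t1 : t < 1 by near: t; apply: nbhs_right_lt.
have := cf (Itv01 (ltW t0) (ltW t1)) y x (in_setT _) (in_setT _).
change (f (t *: y + (1 - t) *: x) <= t * f y + (1 - t) * f x ->
  t^-1 * (f (t *: (y - x) + x) - f x) <= f y - f x).
have -> : t *: y + (1 - t) *: x = t *: (y - x) + x.
  by rewrite scalerBr scalerBl scale1r addrCA addrC addrAC.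
move=> h; rewrite ler_pdivrMl//; lra.
Unshelve. all: by end_near. Qed.

(** Convexity in terms of the gradient: in this form it passes from the sample
    functions to their mean, by taking means of both sides. *)
Definition tangent_convex f := forall x y, f x + dotp (grad f x) (y - x) <= f y.

Lemma grad_lipschitz_sq (L : R) f x y : 0 <= L -> grad_lipschitz L f ->
  dotp (grad f x - grad f y) (grad f x - grad f y) <=
    L ^+ 2 * dotp (x - y) (x - y).
Proof.
move=> L0 hL; rewrite -!enorm_sqE -exprMn.
by rewrite ler_pXn2r// ?nnegrE ?mulr_ge0 ?enorm_ge0.
Qed.

(** The tangent inequality at [u] bounds [f u - f x] by the slope at [u];
    exchanging it for the slope at [x] costs [L |u - x|^2], because
    [2 L <a, v> <= |a|^2 + L^2 |v|^2] for [a] the difference of the gradients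
    and [v = u - x]. *)
Lemma descent (L : R) f x u : 0 < L -> grad_lipschitz L f -> tangent_convex f ->
  f u <= f x + dotp (grad f x) (u - x) + L * dotp (u - x) (u - x).
Proof.
move=> L0 hL cf.
have h1 := cf u x.
have h2 := grad_lipschitz_sq u x (ltW L0) hL.
set a := grad f u in h1 h2 *; set b := grad f x in h2 *.
set v := u - x in h2 *.
have h3 := dotp_ge0 ((a - b) - L *: v).
have vE : x - u = - v by rewrite opprB.
rewrite vE in h1.
clearbody v a b.
move: h1 h2 h3; rewrite !dotpE (dotpC b a) (dotpC v a) (dotpC v b) => h1 h2 h3.
have : 2 * L * (dotp a v - dotp b v) <= 2 * L * (L * dotp v v) by nra.
rewrite ler_pM2l ?mulr_gt0// => h; lra.
Qed.

(** The gradient step [x - (2 L)^-1 *: grad f x] decreases [f] by at least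
    [|grad f x|^2 / (4 L)], and cannot lead below [m]. *)
Lemma grad_le_gap (L : R) f x m :
  0 < L -> grad_lipschitz L f -> tangent_convex f ->
  (forall y, m <= f y) ->
  dotp (grad f x) (grad f x) <= 4 * L * (f x - m).
Proof.
move=> L0 hL cf hm; set g := grad f x.
have := le_trans (hm _) (@descent L f x (x - (2 * L)^-1 *: g) L0 hL cf).
have -> : x - (2 * L)^-1 *: g - x = - ((2 * L)^-1 *: g).
  by rewrite addrAC subrr add0r.
rewrite -/g !dotpE.
set s := dotp g g => h.
have L2 : L * (2 * L)^-1 = 2^-1 by field; rewrite gt_eqF.
have {}h : m <= f x - (2 * L)^-1 * s * 2^-1.
  apply: le_trans h _; rewrite opprK mulrA mulrA L2; lra.
have : s * 1 <= 4 * L * (f x - m); last by rewrite mulr1.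
have -> : s * 1 = 4 * L * ((2 * L)^-1 * s * 2^-1) by field; rewrite gt_eqF.
by rewrite ler_pM2l ?mulr_gt0//; lra.
Qed.

Lemma grad_min (L : R) f x : 0 < L -> grad_lipschitz L f -> tangent_convex f ->
  (forall y, f x <= f y) -> grad f x = 0.
Proof.
move=> L0 hL cf hx; apply: dotp0_eq0; apply/eqP; rewrite eq_le dotp_ge0 andbT.
by have := grad_le_gap x L0 hL cf hx; rewrite subrr mulr0.
Qed.

(** The right-hand side is the gap at [x] of [f] minus its tangent at [y], a
    function that is minimal at [y]; as in [grad_le_gap], the point [u] is one
    gradient step of that function from [x]. *)
Lemma grad_diff_le_bregman (L : R) f x y :
  0 < L -> grad_lipschitz L f -> tangent_convex f ->
  dotp (grad f x - grad f y) (grad f x - grad f y) <=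
   4 * L * (f x - f y - dotp (grad f y) (x - y)).
Proof.
move=> L0 hL cf; set g := grad f x; set h := grad f y.
pose u := x - (2 * L)^-1 *: (g - h).
have h1 := @descent L f x u L0 hL cf.
have h2 := cf y u.
have := le_trans h2 h1; rewrite -/g -/h.
have -> : u - x = - ((2 * L)^-1 *: (g - h)) by rewrite /u addrAC subrr add0r.
have -> : u - y = (x - y) - ((2 * L)^-1 *: (g - h)) by rewrite /u addrAC.
set w := g - h; rewrite (dotpDr (x - y)) !dotpNr !dotpNl !dotpZr !dotpZl.
have -> : dotp g w = dotp w w + dotp h w by rewrite -dotpDl subrK.
set s := dotp w w; set q := dotp h (x - y) => H.
have L2 : L * (2 * L)^-1 = 2^-1 by field; rewrite gt_eqF.
have {}H : (2 * L)^-1 * s * 2^-1 <= f x - f y - q.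
  move: H; rewrite opprK mulrA mulrA L2 => H; lra.
have -> : s = 4 * L * ((2 * L)^-1 * s * 2^-1) by field; rewrite gt_eqF.
by rewrite ler_pM2l ?mulr_gt0//; lra.
Qed.

End SmoothConvex.

(** * Borel measurability of vector-valued maps *)

Section BorelVector.
Context {R : realType} {n : nat}.

Definition rat_box (pq : 'rV[rat]_n * 'rV[rat]_n) : set 'rV[R]_n :=
  [set v | forall i, ratr (pq.1 ord0 i) < v ord0 i < ratr (pq.2 ord0 i)].

(** The rational boxes form a countable base; this is why the Borel sets of the
    space of vectors are generated by the coordinates. *)
Lemma open_rV_bigcup_box (U : set 'rV[R]_n) : open U ->
  U = \bigcup_(pq in [set pq | rat_box pq `<=` U]) rat_box pq.
Proof.
move=> oU; apply/seteqP; split=> [v Uv|v [pq sU]]; last exact: sU.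
have : nbhs v U by rewrite nbhsE /=; exists U.
move/nbhs_ballP => [e /= e0 eU].
have hp i : {q : rat | v ord0 i - e < ratr q < v ord0 i}.
  apply: cid; have /rat_in_itvoo[q] : v ord0 i - e < v ord0 i by rewrite gtrBl.
  by rewrite in_itv /=; exists q.
have hq i : {q : rat | v ord0 i < ratr q < v ord0 i + e}.
  apply: cid; have /rat_in_itvoo[q] : v ord0 i < v ord0 i + e by rewrite ltrDl.
  by rewrite in_itv /=; exists q.
exists (\row_i sval (hp i), \row_i sval (hq i)); last first.
  move=> i /=; rewrite !mxE; case: (hp i) => q /= /andP[_ ->].
  by case: (hq i) => ? /= /andP[->].
move=> w /= hw; apply: eU; split=> // j i; rewrite (ord1 j).
rewrite /ball /= ltr_norml; move: (hw i) => /=; rewrite !mxE.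
case: (hp i) => p /= /andP[? ?]; case: (hq i) => q /= /andP[? ?] /andP[? ?].
by lra.
Qed.

Lemma measurable_fun_rV d (T : measurableType d) (g : T -> borel 'rV[R]_n) :
  (forall i, measurable_fun [set: T] (fun t => (g t : 'rV[R]_n) ord0 i)) ->
  measurable_fun [set: T] g.
Proof.
move=> mg; apply: (@measurability _ _ T (borel 'rV[R]_n) setT g (@open _)) => //.
move=> _ [U oU <-]; rewrite setTI (open_rV_bigcup_box oU) preimage_bigcup.
set F := fun pq => g @^-1` rat_box pq.
have mF pq : measurable (F pq).
  have -> : F pq = \bigcap_(i in [set: 'I_n])
    ((fun t => (g t : 'rV[R]_n) ord0 i) @^-1`
       `]ratr (pq.1 ord0 i), ratr (pq.2 ord0 i)[%classic).
    apply/seteqP; split=> [t Ft i _ /=|t Ft i].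
      by rewrite in_itv; exact: Ft.
    by have := Ft i I; rewrite /= in_itv.
  apply: fin_bigcap_measurable => // i _.
  by rewrite -[X in measurable X]setTI; apply: mg.
rewrite bigcup_mkcond; set G := (X in measurable (bigcup _ X)).
have mG pq : measurable (G pq).
  by rewrite /G; case: ifPn => _; [exact: mF|exact: measurable0].
(* Pairs of rational vectors are countable: index the union by their codes. *)
have -> : \bigcup_pq G pq = \bigcup_k oapp G set0 (choice.unpickle k).
  apply/seteqP; split=> [t [pq _ Gt]|t [k _]].
    by exists (choice.pickle pq) => //; rewrite choice.pickleK.
  by case: (choice.unpickle k) => // pq Gt; exists pq.
apply: bigcupT_measurable => k; case: (choice.unpickle k) => [pq|].
  exact: mG.
exact: measurable0.
Qed.

Lemma measurable_continuous (h : 'rV[R]_n -> R) : continuous h ->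
  measurable_fun [set: borel 'rV[R]_n] (h : borel 'rV[R]_n -> R).
Proof.
move=> /continuousP ch.
apply: (measurability _ (RGenOpens.measurableE R)).
move=> _ [_ [a [b ->] <-]]; rewrite setTI; apply: sub_sigma_algebra.
exact/ch/interval_open.
Qed.

Lemma measurable_coord d (T : measurableType d) (g : T -> borel 'rV[R]_n) i :
  measurable_fun [set: T] g ->
  measurable_fun [set: T] (fun t => (g t : 'rV[R]_n) ord0 i).
Proof.
apply: (measurableT_comp
  (f := fun v : borel 'rV[R]_n => (v : 'rV[R]_n) ord0 i)).
apply: measurable_continuous; exact: coord_continuous.
Qed.

End BorelVector.

(** * Integrating out a sample independent of the past *)

Section Past.
Context {R : realType} {d d' : measure_display}.
Context {Omega : measurableType d} {T : measurableType d'}.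
Context {P : probability Omega R} (Zs : nat -> {RV P >-> T}).

(** A generator of the sigma-algebra of the samples [0..n].  Mutual independence
    speaks about sets of this product form, and since they are stable under
    intersection, identities between finite measures extend from them to the
    whole sigma-algebra. *)
Definition past_cylinders (n : nat) : set (set Omega) :=
  [set B | exists2 A : nat -> set T, (forall i, measurable (A i)) &
     B = \bigcap_(i in `I_n.+1) Zs i @^-1` A i].

Notation past n := (g_sigma_algebraType (past_cylinders n)).

Lemma past_cylinders_measurable n : past_cylinders n `<=` measurable.
Proof.
move=> _ [A mA ->]; apply: fin_bigcap_measurable => // i _.
exact: measurable_funPTI.
Qed.

Lemma past_cylindersI n : setI_closed (past_cylinders n).
Proof.
move=> _ _ [A mA ->] [B mB ->]; exists (fun i => A i `&` B i).
  by move=> i; exact: measurableI.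
by rewrite -bigcapI.
Qed.

Lemma past_cylindersT n : past_cylinders n [set: Omega].
Proof.
exists (fun=> [set: T]) => //; apply/seteqP; split=> // w _ i _.
Qed.

Lemma past_cylinders_mono m n : (m <= n)%N ->
  past_cylinders m `<=` past_cylinders n.
Proof.
move=> mn _ [A mA ->]; exists (fun i => if (i <= m)%N then A i else [set: T]).
  by move=> i; case: ifP.
apply/seteqP; split=> w /= h i /= ilt.
  by case: ifPn => // im; apply: h.
have im : (i <= m)%N by [].
by have /= := h i (leq_trans im mn); rewrite im; exact.
Qed.

Lemma measurable_past n (A : set Omega) : measurable (A : set (past n)) ->
  measurable A.
Proof.
apply: smallest_sub; first exact: sigma_algebra_measurable.
exact: past_cylinders_measurable.
Qed.

Lemma measurable_fun_past_mono d2 (T2 : measurableType d2) m n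
    (g : Omega -> T2) : (m <= n)%N ->
  measurable_fun [set: past m] (g : past m -> T2) ->
  measurable_fun [set: past n] (g : past n -> T2).
Proof.
move=> mn mg _ A mA; have := mg measurableT A mA.
apply: sub_smallest2r; first exact: smallest_sigma_algebra.
exact: past_cylinders_mono.
Qed.

Lemma measurable_fun_past d2 (T2 : measurableType d2) n (g : Omega -> T2) :
  measurable_fun [set: past n] (g : past n -> T2) ->
  measurable_fun [set: Omega] g.
Proof. by move=> mg _ A mA; apply: (@measurable_past n); exact: mg. Qed.

Lemma measurable_past_idx n i : (i <= n)%N ->
  measurable_fun [set: past n] (Zs i : past n -> T).
Proof.
move=> ilen _ A mA; rewrite setTI; apply: sub_sigma_algebra.
exists (fun j => if j == i then A else [set: T]); first by move=> j; case: ifP.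
apply/seteqP; split=> w /=.
  by move=> wA j _ /=; case: eqP => [->|].
by move=> /(_ i); rewrite /= eqxx ltnS; exact.
Qed.

Hypothesis hind : mutually_independent Zs.

Lemma indep_cylinder n (B : set Omega) (C : set T) :
  past_cylinders n B -> measurable C ->
  P (B `&` Zs n.+1 @^-1` C) = (P B * P (Zs n.+1 @^-1` C))%E.
Proof.
move=> [A mA ->] mC.
pose J k := [fset i | i in iota 0 k]%fset.
have JE k i : (i \in J k) = (i < k)%N.
  rewrite /J; apply/imfsetP/idP => /= [[x]|ik]; first by rewrite mem_iota => ? ->.
  by exists i; rewrite ?mem_iota.
have set_J k : [set` J k] = `I_k by apply/seteqP; split=> i /=; rewrite JE.
pose A' i := if i == n.+1 then C else A i.
have prodJ k (F : nat -> \bar R) :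
    (\prod_(i <- J k) F i = \prod_(i <- iota 0 k) F i)%E.
  apply: perm_big; apply: uniq_perm; rewrite ?iota_uniq ?fset_uniq// => i.
  by rewrite JE mem_iota.
have := hind (J := J n.+1) (A := A) (fun i _ => mA i).
rewrite set_J prodJ => ->.
have := hind (J := J n.+2) (A := A').
rewrite set_J prodJ -(addn1 n.+1) iotaD big_cat big_seq1 add0n => hn.
have AN : A' n.+1 = C by rewrite /A' eqxx.
rewrite AN in hn.
transitivity (P (\bigcap_(i < n.+1 + 1) Zs i @^-1` A' i)).
  congr (P _); apply/seteqP; split=> w /=.
    move=> [wA wC] i /=; rewrite addn1 ltnS leq_eqVlt /A'.
    by case: eqP => [->|_ /= ?] //; exact: wA.
  move=> wA; split=> [i /= ilt|].
    have := wA i; rewrite /= addn1 => /(_ (ltnW ilt)).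
    by rewrite /A' ltn_eqF.
  by have := wA n.+1; rewrite /= addn1 => /(_ (ltnSn _)); rewrite /A' eqxx.
rewrite hn; last by move=> i _; rewrite /A'; case: ifP.
congr (_ * _)%E; apply: eq_big_seq => i; rewrite mem_iota => /andP[_ ilt].
by rewrite /A' ltn_eqF.
Qed.

(** Both sides are finite measures of [B], and they agree on the cylinders. *)
Lemma indep_past n (B : set Omega) (C : set T) :
  measurable (B : set (past n)) -> measurable C ->
  P (B `&` Zs n.+1 @^-1` C) = (P B * P (Zs n.+1 @^-1` C))%E.
Proof.
move=> mB mC; set E := Zs n.+1 @^-1` C.
have mE : measurable E by exact: measurable_funPTI.
have PE : 0 <= fine (P E) by rewrite fine_ge0.
pose m2 := mscale (NngNum PE) P.
transitivity (m2 B); last first.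
  by rewrite /m2 /mscale /= fineK ?fin_num_measure// muleC.
apply: (g_sigma_algebra_measure_unique (past_cylinders n)
  (past_cylinders_measurable (n := n)) (fun=> setT)
  (fun=> past_cylindersT n) _ (mrestr P mE)) => //.
- by rewrite bigcup_const//; exists 0%N.
- exact: past_cylindersI.
- move=> A AG; have AE := indep_cylinder AG mC.
  rewrite /mrestr [LHS]AE [RHS](_ : _ = (fine (P E))%:E * P A)%E//.
  by rewrite fineK ?fin_num_measure// muleC.
- move=> _; rewrite [X in (X < _)%E](_ : _ = P E) /mrestr ?setTI//.
  by rewrite (le_lt_trans (probability_le1 P mE))// ltry.
  exact: (congr1 P (setTI E)).
Qed.

(** The joint law of the past and the next sample is a product measure, so that
    Tonelli's theorem applies.  This plays the part of conditioning on the
    past: the past enters through the identity map of [Omega], measurable for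
    the coarser sigma-algebra. *)
Lemma integral_past_next n (mu : probability T R)
    (hlaw : forall A, measurable A -> distribution P (Zs n.+1) A = mu A)
    (phi : past n * T -> \bar R) :
  measurable_fun [set: past n * T] phi -> (forall x, (0 <= phi x)%E) ->
  (\int[P]_w phi (w : past n, Zs n.+1 w) =
   \int[P]_w \int[mu]_z phi (w : past n, z))%E.
Proof.
move=> mphi phi0.
have mid : measurable_fun [set: Omega] (fun w => w : past n).
  by move=> _ A mA; rewrite setTI; apply: (@measurable_past n).
pose idp : {mfun Omega >-> past n} :=
  HB.pack (fun w : Omega => w : past n) (isMeasurableFun.Build _ _ _ _ _ mid).
have mpair : measurable_fun [set: Omega] (fun w => (w : past n, Zs n.+1 w)).
  exact: measurable_fun_pair.
pose pr : {mfun Omega >-> (past n * T)%type} :=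
  HB.pack (fun w : Omega => (w : past n, Zs n.+1 w))
    (isMeasurableFun.Build _ _ _ _ _ mpair).
transitivity (\int[distribution P pr]_x phi x)%E.
  by rewrite ge0_integral_distribution.
transitivity (\int[distribution P idp \x mu]_x phi x)%E.
  apply: eq_measure_integral => A mA _; apply/esym.
  apply: product_measure_unique => // B C mB mC.
  by rewrite -[RHS]/(P B * mu C)%E -(hlaw _ mC); exact: indep_past.
rewrite fubini_tonelli1//.
rewrite ge0_integral_distribution//.
- exact: measurable_fun_fubini_tonelli_F.
- by move=> w; apply: integral_ge0.
Qed.

End Past.

(** * Suffix averages *)

(** In this section time runs backwards from the last iterate: [G i] and [Phi i]
    are the step size and the expected gap [i] steps before the end, [V j] and
    [T j / V j] the total weight and the weighted average gap over the last
    [j+1] iterates.  The hypothesis [regret] says that the iterates following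
    the one with index [j] are, on average, not much worse than it. *)
Section SuffixAverages.
Context {R : realType}.
Variables (G Phi : nat -> R) (A B : R) (p : nat).
Hypotheses (A0 : 0 < A) (B0 : 0 <= B) (G0 : 0 < G 0%N).
Hypothesis ndG : forall i j, (i <= j <= p)%N -> G i <= G j.
Hypothesis G2 : forall i, (i <= p)%N -> G i <= 2 * G 0%N.
Hypothesis Phi0 : forall i, 0 <= Phi i.
Hypothesis regret : forall j, (j <= p)%N ->
  2 * \sum_(i < j.+1) G i * (Phi i - Phi j) <=
  \sum_(i < j.+1) G i ^+ 2 * (A * Phi i + B).

Let V j := \sum_(i < j.+1) G i.
Let T j := \sum_(i < j.+1) G i * Phi i.

Lemma suffix_weight_ge j : (j <= p)%N -> j.+1%:R * G 0%N <= V j.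
Proof.
move=> jp; rewrite mulr_natl -[in leLHS](card_ord j.+1) -sumr_const.
by apply: ler_sum => i _; apply: ndG; rewrite leq0n /= (leq_trans _ jp)// -ltnS.
Qed.

Let V_gt0 j : (j <= p)%N -> 0 < V j.
Proof.
by move=> jp; apply: lt_le_trans (suffix_weight_ge jp); rewrite mulr_gt0.
Qed.

(** Removing the oldest iterate from the average raises it only if the gap of
    that iterate is below the average, and [regret] limits by how much it can
    be.  The noise in [regret] is itself bounded by [A S + B] times the weights,
    with [S] the longer average, hence the multiplicative form. *)
Lemma suffix_average_step j : (j < p)%N ->
  A * (T j / V j) + B <=
  (A * (T j.+1 / V j.+1) + B) * (1 + 2 * A * G 0%N / j.+1%:R).
Proof.
move=> jp; have Vj := V_gt0 (ltnW jp); have VS := V_gt0 jp.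
set S := T j.+1 / V j.+1; set G' := G j.+1; set Phi' := Phi j.+1.
have ES : V j.+1 * S = T j.+1 by rewrite /S mulrC divfK// gt_eqF.
have EV : V j.+1 = V j + G' by rewrite /V big_ord_recr.
have ET : T j.+1 = T j + G' * Phi' by rewrite /T big_ord_recr.
have G'0 : 0 < G' by apply: lt_le_trans G0 _; apply: ndG; rewrite leq0n.
have H : 2 * (T j.+1 - V j.+1 * Phi') <= G' * (A * T j.+1 + B * V j.+1).
  have -> : T j.+1 - V j.+1 * Phi' = \sum_(i < j.+2) G i * (Phi i - Phi').
    rewrite /T /V mulr_suml -sumrB; apply: eq_bigr => i _; by rewrite mulrBr.
  apply: le_trans (regret jp) _.
  rewrite /T /V !mulr_sumr -big_split mulr_sumr /=; apply: ler_sum => i _.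
  have -> : A * (G i * Phi i) + B * G i = G i * (A * Phi i + B) by ring.
  have Gi : 0 <= G i.
    apply: le_trans (ltW G0) _; apply: ndG; rewrite leq0n /=.
    by rewrite (leq_trans _ jp)// -ltnS.
  rewrite expr2 -mulrA ler_wpM2r//.
    by rewrite mulr_ge0// addr_ge0// mulr_ge0// ltW.
  by apply: ndG; rewrite -ltnS ltn_ord.
have T0 : 0 <= T j.+1.
  apply: sumr_ge0 => i _; rewrite mulr_ge0//.
  apply: le_trans (ltW G0) _; apply: ndG; rewrite leq0n /=.
  by rewrite (leq_trans _ jp)// -ltnS.
have S0 : 0 <= S by rewrite divr_ge0// ltW.
set u := A * S + B.
have u0 : 0 <= u by rewrite addr_ge0// mulr_ge0// ltW.
have {}H : 2 * (S - Phi') <= G' * u.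
  rewrite -(ler_pM2l VS); move: H; rewrite -ES /u => H; nra.
have TV : T j <= V j * (S + G' ^+ 2 * u / (2 * V j)).
  rewrite mulrDr.
  have -> : V j * (G' ^+ 2 * u / (2 * V j)) = G' ^+ 2 * u / 2.
    by field; rewrite gt_eqF.
  have : T j = V j * S + G' * (S - Phi').
    by rewrite -[T j](addrK (G' * Phi')) -ET -ES EV; ring.
  by move=> ->; rewrite lerD2l; nra.
have {}TV : T j / V j <= S + G' ^+ 2 * u / (2 * V j).
  by rewrite ler_pdivrMr// mulrC.
apply: (@le_trans _ _ (A * (S + G' ^+ 2 * u / (2 * V j)) + B)).
  by rewrite lerD2r ler_pM2l.
have -> : A * (S + G' ^+ 2 * u / (2 * V j)) + B =
          u * (1 + A * G' ^+ 2 / (2 * V j)).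
  by rewrite /u; field; rewrite gt_eqF.
rewrite ler_wpM2l// lerD2l.
have G'2 : G' <= 2 * G 0%N by exact: G2.
have Vge := suffix_weight_ge (ltnW jp).
have : 0 < j.+1%:R :> R by rewrite ltr0n.
move: (j.+1%:R) Vge => c Vge c0; rewrite ler_pdivrMr ?mulr_gt0//.
have -> : 2 * A * G 0%N / c * (2 * V j) = A * (4 * G 0%N * (V j / c)).
  by field; rewrite gt_eqF.
rewrite ler_pM2l//.
apply: (@le_trans _ _ (4 * G 0%N * G 0%N)); first nra.
by rewrite ler_pM2l ?mulr_gt0// ler_pdivlMr// mulrC.
Qed.

(** The shortest average is the gap of the last iterate.  The product of the
    factors of [suffix_average_step] is at most [expR s], and
    [expR s - 1 <= s * expR s] turns the contribution of [B], which is not a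
    gap, into one of order [s]. *)
Lemma last_le_suffix_average (h := \sum_(j < p) (j.+1%:R)^-1)
    (s := 2 * A * G 0%N * h) :
  Phi 0%N <= expR s * (T p / V p + 2 * B * G 0%N * h).
Proof.
have a0 : 0 <= 2 * A * G 0%N by rewrite !mulr_ge0// ltW.
have T0 j : (j <= p)%N -> 0 <= T j.
  move=> jp; apply: sumr_ge0 => i _; rewrite mulr_ge0//.
  apply: le_trans (ltW G0) _; apply: ndG; rewrite leq0n /=.
  by rewrite (leq_trans _ jp)// -ltnS.
have u0 j : (j <= p)%N -> 0 <= A * (T j / V j) + B.
  by move=> jp; rewrite addr_ge0// mulr_ge0 ?divr_ge0 ?T0 ?ltW// V_gt0.
have main j : (j <= p)%N -> A * Phi 0%N + B <=
    (A * (T j / V j) + B) * expR (2 * A * G 0%N * \sum_(i < j) (i.+1%:R)^-1).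
  elim: j => [|j IH] jp.
    rewrite big_ord0 mulr0 expR0 mulr1 /T /V !big_ord_recl !big_ord0 !addr0.
    by rewrite mulrAC divff ?mul1r// gt_eqF.
  apply: le_trans (IH (ltnW jp)) _.
  rewrite big_ord_recr /= mulrDr expRD.
  rewrite [leRHS]mulrCA [leRHS]mulrC ler_wpM2r ?expR_ge0//.
  apply: le_trans (suffix_average_step jp) _.
  by rewrite ler_wpM2l ?u0// expR_ge1Dx.
have := main p (leqnn p); rewrite -/h -/s => {}main.
have s_exp : expR s - 1 <= s * expR s.
  have := expR_ge1Dx (- s); rewrite expRN => es.
  have := expR_gt0 s => e0.
  have : (1 - s) * expR s <= 1.
    by rewrite -[leRHS](@mulVf _ (expR s)) ?gt_eqF// ler_pM2r.
  lra.
rewrite -(ler_pM2l A0).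
have -> : A * (expR s * (T p / V p + 2 * B * G 0%N * h)) =
          expR s * (A * (T p / V p)) + B * (s * expR s) by rewrite /s; ring.
have : B * (expR s - 1) <= B * (s * expR s) by rewrite ler_wpM2l.
move: main; lra.
Qed.

End SuffixAverages.

(** * Polynomial step sizes *)

Section Steps.
Context {R : realType}.
Implicit Types (a y : R).

Lemma ln_succ_ge n : n.+2%:R^-1 <= ln n.+2%:R - ln n.+1%:R :> R.
Proof.
have n2 : 0 < n.+2%:R :> R by rewrite ltr0n.
have n1 : 0 < n.+1%:R :> R by rewrite ltr0n.
rewrite -lerN2 opprB -ln_div ?posrE//.
have -> : n.+1%:R / n.+2%:R = 1 + (- n.+2%:R^-1) :> R.
  rewrite -[n.+2]addn1 natrD; move: (n.+1%:R) n1 => c c0.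
  by field; rewrite gt_eqF// addr_gt0.
by apply: le_ln1Dx; rewrite ltrN2 invf_lt1// ltr1n.
Qed.

(** The number of terms is decoupled from the argument of the logarithm, so that
    a sum over half of the iterates is bounded in terms of their total number. *)
Lemma harmonic_le_ln p n : (p <= n.+1)%N ->
  \sum_(i < p) (i.+1%:R : R)^-1 <= 1 + ln n.+1%:R.
Proof.
case: p => [|p] pn; first by rewrite big_ord0 addr_ge0// ln_ge0// ler1n.
suff h : \sum_(i < p.+1) (i.+1%:R : R)^-1 <= 1 + ln p.+1%:R.
  by apply: le_trans h _; rewrite lerD2l ler_ln ?posrE ?ltr0n// ler_nat.
elim: p {pn} => [|p IH]; first by rewrite big_ord_recl big_ord0 ln1 invr1.
rewrite big_ord_recr /=.
apply: le_trans (lerD IH (ln_succ_ge p)) _.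
by rewrite -addrA (addrC (ln _)) subrK.
Qed.

Variables (gamma alpha : R).
Hypotheses (hgamma : 0 < gamma) (halpha : 0 < alpha < 1).
Let g (n : nat) := gamma * n.+1%:R `^ (- alpha).

Let alpha0 : 0 < alpha. Proof. by case/andP: halpha. Qed.

Lemma step_gt0 n : 0 < g n.
Proof. by rewrite mulr_gt0// powR_gt0// ltr0n. Qed.

Lemma step_noninc m n : (m <= n)%N -> g n <= g m.
Proof.
move=> mn; rewrite ler_pM2l// !powRN lef_pV2 ?posrE ?powR_gt0 ?ltr0n//.
by apply: ge0_ler_powR; rewrite ?nnegrE ?ler0n ?ler_nat// ltW.
Qed.

Lemma step_double m n : (n.+1 <= m.+1.*2)%N -> g m <= 2 * g n.
Proof.
move=> nm; rewrite /g mulrCA ler_pM2l// !powRN.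
rewrite ler_pdivlMr ?powR_gt0 ?ltr0n// mulrC ler_pdivrMr ?powR_gt0 ?ltr0n//.
have n0 : 0 <= m.+1%:R :> R by rewrite ler0n.
apply: (@le_trans _ _ ((2 * m.+1%:R) `^ alpha)).
  apply: ge0_ler_powR; rewrite ?nnegrE ?mulr_ge0 ?ler0n ?(ltW alpha0)//.
  by rewrite -natrM ler_nat mul2n.
rewrite powRM// ler_wpM2r ?powR_ge0//.
by apply: ler1_powR; [rewrite ler1n|case/andP: halpha => _ /ltW].
Qed.

Lemma step_eventually_small (A : R) :
  exists n0, forall n, (n0 <= n)%N -> A * g n <= 1.
Proof.
pose c := (`|A| * gamma) `^ alpha^-1.
exists (Num.bound c) => n hn.
have c0 : 0 <= c by exact: powR_ge0.
have Ag : 0 <= `|A| * gamma by rewrite mulr_ge0// ltW.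
have cn : c <= n.+1%:R.
  rewrite (le_trans (ltW (archi_boundP c0)))// ler_nat.
  exact: leq_trans hn (leqnSn _).
have h : `|A| * gamma <= n.+1%:R `^ alpha.
  rewrite -[leLHS](powRr1 Ag) -[X in _ `^ X](mulVf (lt0r_neq0 alpha0)) powRrM.
  by apply: ge0_ler_powR; rewrite ?nnegrE ?ler0n// ltW.
apply: (@le_trans _ _ (`|A| * g n)).
  by rewrite ler_wpM2r ?ler_norm// ltW// step_gt0.
by rewrite /g mulrA powRN ler_pdivrMr ?powR_gt0 ?ltr0n// mul1r.
Qed.

(** Write [(n+1)^(-2 alpha)] as [(n+1)^(1 - 2 alpha) / (n+1)]: the numerator is
    at most [(N+1)^(max 0 (1 - 2 alpha))], and a harmonic sum remains.  This
    treats [alpha] below, at and above [1/2] at once, at the price of a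
    logarithm. *)
Lemma sum_step_sq N : \sum_(n < N.+1) g n ^+ 2 <=
  gamma ^+ 2 * ((1 + ln N.+1%:R) * N.+1%:R `^ (Num.max 0 (1 - 2 * alpha))).
Proof.
set mu := Num.max _ _.
have mu0 : 0 <= mu by rewrite le_max lexx.
have term n : (n < N.+1)%N ->
    g n ^+ 2 <= gamma ^+ 2 * N.+1%:R `^ mu * n.+1%:R^-1.
  move=> nN; rewrite exprMn -mulrA ler_pM2l ?exprn_gt0//.
  have y1 : 1 <= n.+1%:R :> R by rewrite ler1n.
  rewrite -powR_mulrn ?powR_ge0// -powRrM.
  have -> : - alpha * 2 = (1 - 2 * alpha) + (- 1) by ring.
  rewrite powRD; last by apply/implyP => _; rewrite pnatr_eq0.
  rewrite powR_inv1 ?ler0n//.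
  rewrite ler_wpM2r ?invr_ge0 ?ler0n//.
  apply: (@le_trans _ _ (n.+1%:R `^ mu)).
    by apply: ler_powR => //; rewrite le_max lexx orbT.
  by apply: ge0_ler_powR; rewrite ?nnegrE ?ler0n ?ler_nat.
apply: (@le_trans _ _
  (\sum_(n < N.+1) gamma ^+ 2 * N.+1%:R `^ mu * n.+1%:R^-1)).
  by apply: ler_sum => n _; exact: term.
rewrite -mulr_sumr -mulrA [X in _ <= _ * X]mulrC.
rewrite !ler_wpM2l ?powR_ge0 ?sqr_ge0//.
exact: harmonic_le_ln.
Qed.

(** Follows from [ln t < t] at [t = y^alpha]. *)
Lemma ln_powR_bound y : 1 <= y -> y `^ (- alpha) * (1 + ln y) <= 1 + alpha^-1.
Proof.
move=> y1; have y0 : 0 < y by lra.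
have ya : 0 < y `^ alpha by exact: powR_gt0.
rewrite powRN mulrC ler_pdivrMr//.
have h1 : 1 <= y `^ alpha by rewrite -(powRr0 y) ler_powR// ltW.
have h2 : ln y <= alpha^-1 * y `^ alpha.
  by rewrite mulrC ler_pdivlMr// mulrC -ln_powR ltW// ln_sublinear.
lra.
Qed.

End Steps.

(** * From the one-step inequalities to the last-iterate rate *)

(** The sequences stand for [F n = E f(X n) - min f], [D n = E |X n - xs|^2]
    with [xs] a minimizer, and [Q n k = E |X n - X k|^2]. *)
Section Rate.
Context {R : realType}.
Variables (gamma alpha A B : R).
Hypotheses (hgamma : 0 < gamma) (halpha : 0 < alpha < 1).
Hypotheses (A0 : 0 < A) (B0 : 0 <= B).
Let g (n : nat) := gamma * n.+1%:R `^ (- alpha).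
Variables (F D : nat -> R) (Q : nat -> nat -> R).
Hypotheses (F0 : forall n, 0 <= F n) (D0 : forall n, 0 <= D n).
Hypotheses (Q0 : forall n k, 0 <= Q n k) (Qkk : forall k, Q k k = 0).
Hypothesis stepD : forall n,
  D n.+1 + 2 * g n * F n <= D n + g n ^+ 2 * (A * F n + B).
Hypothesis stepQ : forall k n, (k <= n)%N ->
  Q n.+1 k + 2 * g n * F n <= Q n k + 2 * g n * F k + g n ^+ 2 * (A * F n + B).

Let g_gt0 n : 0 < g n. Proof. exact: step_gt0. Qed.

(** Once [A * g n <= 1], half of the left-hand side of [stepD] absorbs the part
    of the noise that is proportional to the gap.  Only finitely many steps are
    larger; [c n] is what they fail to absorb. *)
Lemma weighted_gap_sum : exists2 C0, 0 <= C0 &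
  forall N, \sum_(n < N) g n * F n <= C0 + B * \sum_(n < N) g n ^+ 2.
Proof.
have [n0 small] := step_eventually_small hgamma halpha A.
pose c n := Num.max 0 ((A * g n - 1) * (g n * F n)).
have c0 n : 0 <= c n by rewrite le_max lexx.
have cz n : (n0 <= n)%N -> c n = 0.
  move=> hn; apply: max_l; apply: mulr_le0_ge0.
    by rewrite subr_le0; exact: small.
  by rewrite mulr_ge0// ltW.
have csum N : \sum_(0 <= n < N) c n <= \sum_(0 <= n < n0) c n.
  have [Nn0|n0N] := leqP N n0.
    by rewrite [leRHS](big_cat_nat (leq0n N) Nn0)/= lerDl sumr_ge0.
  rewrite (big_cat_nat (leq0n n0) (ltnW n0N))/=.
  rewrite [X in _ + X <= _]big1_seq ?addr0// => n /=.
  by rewrite mem_index_iota => /andP[hn _]; exact: cz.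
have main N : \sum_(0 <= n < N) g n * F n + D N <=
    D 0%N + B * \sum_(0 <= n < N) g n ^+ 2 + \sum_(0 <= n < N) c n.
  elim: N => [|N IH]; first by rewrite !big_nil; lra.
  rewrite !big_nat_recr//=.
  have hc : (A * g N - 1) * (g N * F N) <= c N by rewrite le_max lexx orbT.
  have := stepD N; nra.
exists (D 0%N + \sum_(0 <= n < n0) c n); first by rewrite addr_ge0// sumr_ge0.
move=> N; rewrite -(big_mkord predT (fun n => g n * F n)).
rewrite -(big_mkord predT (fun n => g n ^+ 2)).
have := main N; have := csum N; have := D0 N; lra.
Qed.

(** The inequalities [stepQ] telescope, starting from [Q k k = 0]. *)
Lemma regret_bound k m : (k <= m)%N ->
  2 * \sum_(k <= n < m) g n * (F n - F k) <=
  \sum_(k <= n < m) g n ^+ 2 * (A * F n + B).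
Proof.
move=> km; suff : Q m k + 2 * \sum_(k <= n < m) g n * (F n - F k) <=
  \sum_(k <= n < m) g n ^+ 2 * (A * F n + B).
  by have := Q0 m k; lra.
elim: m km => [|m IH].
  by rewrite leqn0 => /eqP ->; rewrite Qkk !big_nil; lra.
rewrite leq_eqVlt => /orP[/eqP ->|]; first by rewrite Qkk !big_geq//; lra.
rewrite ltnS => km; rewrite !big_nat_recr//=.
by have := IH km; have := stepQ km; lra.
Qed.

(** The suffix average is taken over the last [N./2 + 1] iterates: within this
    range the step sizes differ at most by a factor 2, and the total weight is
    still at least half of [N+1] times the last step size. *)
Theorem last_iterate_rate : exists2 C, 0 <= C & forall N,
  F N <= C * ((1 + ln N.+1%:R) ^+ 2 / N.+1%:R `^ Num.min alpha (1 - alpha)).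
Proof.
have [C0 C00 hC0] := weighted_gap_sum.
pose c := 2 * A * gamma * (1 + alpha^-1).
pose K := 2 / gamma * (C0 + B * gamma ^+ 2) + 2 * B * gamma.
have [a0 a1] := andP halpha.
have K0 : 0 <= K.
  apply: addr_ge0; last by rewrite !mulr_ge0// ltW.
  apply: mulr_ge0; first by rewrite divr_ge0// ltW.
  by rewrite addr_ge0// mulr_ge0// sqr_ge0.
exists (expR c * K); first by rewrite mulr_ge0// expR_ge0.
move=> N; set y : R := N.+1%:R; set l := 1 + ln y; set kap := Num.min _ _.
have y1 : 1 <= y by rewrite ler1n.
have y0 : 0 < y by rewrite ltr0n.
have l1 : 1 <= l by rewrite lerDl ln_ge0.
pose p := N./2.
have pN : (p <= N)%N by rewrite /p; clear; lia.
pose G i := g (N - i)%N; pose Phi i := F (N - i)%N.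
pose h : R := \sum_(j < p) (j.+1%:R)^-1.
have hl : h <= l by apply: harmonic_le_ln; exact: leqW.
have h0 : 0 <= h by apply: sumr_ge0 => i _; rewrite invr_ge0 ler0n.
have rev (f : nat -> R) j : (j <= N)%N ->
    \sum_(i < j.+1) f (N - i)%N = \sum_(N - j <= n < N.+1) f n.
  elim: j => [|j IH] jN; first by rewrite big_ord1 subn0 big_nat1.
  rewrite big_ord_recr /= IH ?(ltnW jN)// [RHS]big_ltn ?ltnS ?leq_subr//.
  by rewrite subnSK// addrC.
have gN : G 0%N = gamma * y `^ (- alpha) by rewrite /G subn0.
have gN0 : 0 < G 0%N by exact: g_gt0.
set T := \sum_(i < p.+1) G i * Phi i; set V := \sum_(i < p.+1) G i.
have ndG i j : (i <= j <= p)%N -> G i <= G j.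
  move=> /andP[ij _]; apply: step_noninc => //; exact: leq_sub2l.
have bound : Phi 0%N <= expR (2 * A * G 0%N * h) * (T / V + 2 * B * G 0%N * h).
  apply: last_le_suffix_average => // [i ip|i|j jp].
  - rewrite /G subn0; apply: step_double => //.
    by move: ip; rewrite /p; clear; lia.
  - exact: F0.
  - have jN := leq_trans jp pN.
    rewrite (rev (fun n => g n * (F n - F (N - j)%N)))//.
    rewrite (rev (fun n => g n ^+ 2 * (A * F n + B)))//.
    by apply: regret_bound; rewrite leqW// leq_subr.
have TV : T / V <= 2 / gamma * (C0 + B * gamma ^+ 2) * (l / y `^ kap).
  set mu : R := Num.max 0 (1 - 2 * alpha).
  have muE : mu = 1 - alpha - kap.
    rewrite /mu /kap; case: (leP alpha (1 - alpha)) => ?.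
      by rewrite max_r; lra.
    by rewrite max_l; lra.
  have Y1 : 1 <= y `^ mu by rewrite -(powRr0 y) ler_powR// le_max lexx.
  have V0 : 0 < V.
    by rewrite /V big_ord_recl ltr_pwDl// sumr_ge0// => i _; exact/ltW/g_gt0.
  have Tle : T <= (C0 + B * gamma ^+ 2) * (l * y `^ mu).
    apply: (@le_trans _ _ (\sum_(0 <= n < N.+1) g n * F n)).
      rewrite /T (rev (fun n => g n * F n))//.
      rewrite [leRHS](big_cat_nat (leq0n (N - p)) (leqW (leq_subr p N))) /=.
      by rewrite lerDr sumr_ge0// => n _; rewrite mulr_ge0// ltW.
    rewrite big_mkord; apply: le_trans (hC0 _) _.
    rewrite [leRHS]mulrDl; apply: lerD.
      have lY : 1 <= l * y `^ mu by rewrite -[leLHS]mulr1 ler_pM.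
      by rewrite -[leLHS]mulr1 ler_wpM2l.
    by rewrite -[leRHS]mulrA ler_wpM2l//; exact: sum_step_sq.
  have Vge : gamma / 2 * (y * y `^ (- alpha)) <= V.
    have := @suffix_weight_ge _ G p ndG p (leqnn p); apply: le_trans.
    rewrite gN.
    have -> : gamma / 2 * (y * y `^ (- alpha)) =
              y / 2 * (gamma * y `^ (- alpha)) by ring.
    rewrite ler_pM2r ?mulr_gt0 ?powR_gt0//.
    by rewrite ler_pdivrMr// -natrM ler_nat /p; clear; lia.
  rewrite ler_pdivrMr//; apply: le_trans Tle _.
  apply: (@le_trans _ _ (2 / gamma * (C0 + B * gamma ^+ 2) * (l / y `^ kap) *
      (gamma / 2 * (y * y `^ (- alpha))))).
    rewrite le_eqVlt; apply/orP; left; apply/eqP.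
    have -> : y `^ mu = y * y `^ (- alpha) / y `^ kap.
      rewrite muE powRB; last by rewrite (gt_eqF y0) implybT.
      by rewrite powRD ?powRr1 ?(gt_eqF y0) ?implybT// ltW.
    by field; rewrite !gt_eqF// powR_gt0.
  rewrite ler_wpM2l// !mulr_ge0 ?invr_ge0 ?powR_ge0 ?(ltW hgamma)//.
    by rewrite addr_ge0// mulr_ge0// sqr_ge0.
  exact: le_trans l1.
have gkap : G 0%N <= gamma / y `^ kap.
  rewrite gN powRN ler_pM2l// lef_pV2 ?posrE ?powR_gt0//.
  by apply: ler_powR => //; rewrite ge_min lexx.
have sc : 2 * A * G 0%N * h <= c.
  have : y `^ (- alpha) * h <= 1 + alpha^-1.
    apply: le_trans (ln_powR_bound halpha y1).
    by rewrite ler_wpM2l ?powR_ge0.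
  rewrite /c gN => yh.
  have -> : 2 * A * (gamma * y `^ (- alpha)) * h =
            2 * A * gamma * (y `^ (- alpha) * h) by ring.
  by rewrite ler_pM2l// !mulr_gt0.
have kap0 : 0 < y `^ kap by exact: powR_gt0.
have E : T / V + 2 * B * G 0%N * h <= K * (l ^+ 2 / y `^ kap).
  have r1 : l / y `^ kap <= l ^+ 2 / y `^ kap.
    by rewrite ler_pM2r ?invr_gt0//; nra.
  apply: (@le_trans _ _ (K * (l / y `^ kap))); last by rewrite ler_wpM2l.
  rewrite /K [leRHS]mulrDl; apply: lerD => //.
  have -> : 2 * B * gamma * (l / y `^ kap) =
            2 * B * (gamma / y `^ kap * l) by ring.
  rewrite -[leLHS]mulrA ler_wpM2l ?mulr_ge0//.
  by apply: ler_pM => //; exact: ltW.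
have := bound; rewrite {1}/Phi subn0 => /le_trans; apply.
rewrite -[leRHS]mulrA; apply: ler_pM => //.
  apply: addr_ge0; last by rewrite !mulr_ge0// ltW.
  apply: divr_ge0; apply: sumr_ge0 => i _; last exact/ltW/g_gt0.
  by rewrite mulr_ge0// ?F0// ltW// g_gt0.
by rewrite ler_expR.
Qed.

End Rate.

(** * Means of real and vector-valued functions *)

Section Mean.
Context {R : realType} {disp : measure_display} {T : measurableType disp}.
Variable mu : probability T R.
Implicit Types (f g : T -> R) (m : R).

(** Integrability bundled with the value of the integral: inequalities between
    means become inequalities between real numbers. *)
Definition has_mean f m : Prop :=
  mu.-integrable [set: T] (EFin \o f) /\ (\int[mu]_z (f z)%:E)%E = m%:E.

Lemma has_meanD f g m m' : has_mean f m -> has_mean g m' ->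
  has_mean (fun z => f z + g z) (m + m').
Proof.
move=> [fi fm] [gi gm]; split.
  by have := integrableD measurableT fi gi; apply: eq_integrable.
by rewrite EFinD -fm -gm -integralD_EFin.
Qed.

Lemma has_meanZ f m a : has_mean f m -> has_mean (fun z => a * f z) (a * m).
Proof.
move=> [fi fm]; split.
  by have := integrableZl measurableT a fi; apply: eq_integrable.
by rewrite EFinM -fm -integralZl.
Qed.

Lemma has_mean_cst m : has_mean (fun=> m) m.
Proof.
split; first exact: finite_measure_integrable_cst.
by rewrite integral_cst//= probability_setT mule1.
Qed.

Lemma has_meanB f g m m' : has_mean f m -> has_mean g m' ->
  has_mean (fun z => f z - g z) (m - m').
Proof.
move=> hf /(has_meanZ (-1)) hg.
have := has_meanD hf hg; rewrite mulN1r; congr has_mean.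
by apply/funext => z; rewrite mulN1r.
Qed.

Lemma has_mean_sum n (F : 'I_n -> T -> R) (m : 'I_n -> R) :
  (forall i, has_mean (F i) (m i)) ->
  has_mean (fun z => \sum_(i < n) F i z) (\sum_(i < n) m i).
Proof.
elim: n F m => [|n IH] F m hF.
  rewrite big_ord0; under eq_fun do rewrite big_ord0; exact: has_mean_cst.
rewrite big_ord_recl; under eq_fun do rewrite big_ord_recl.
by apply: has_meanD => //; exact: IH.
Qed.

Lemma has_mean_le f g m m' : has_mean f m -> has_mean g m' ->
  (forall z, f z <= g z) -> m <= m'.
Proof.
move=> [fi fm] [gi gm] fg; rewrite -lee_fin -fm -gm.
by apply: le_integral => // z _; rewrite lee_fin.
Qed.

Lemma has_mean_ge0 f m : has_mean f m -> (forall z, 0 <= f z) -> 0 <= m.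
Proof. exact: has_mean_le (has_mean_cst 0). Qed.

Lemma has_mean_unique f m m' : has_mean f m -> has_mean f m' -> m = m'.
Proof. by move=> [_ hm] [_ hm']; apply: EFin_inj; rewrite -hm -hm'. Qed.

Lemma has_mean_bounded f m : measurable_fun [set: T] f -> (forall z, 0 <= f z) ->
  (\int[mu]_z (f z)%:E <= m%:E)%E -> exists2 m', has_mean f m' & m' <= m.
Proof.
move=> mf f0 fm; have i0 : (0 <= \int[mu]_z (f z)%:E)%E.
  by apply: integral_ge0 => z _; rewrite lee_fin.
have fin : (\int[mu]_z (f z)%:E)%E \is a fin_num.
  by rewrite ge0_fin_numE// (le_lt_trans fm)// ltry.
exists (fine (\int[mu]_z (f z)%:E)%E); last by rewrite -lee_fin fineK.
split; last by rewrite fineK.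
apply/integrableP; split; first exact/measurable_EFinP.
under eq_integral do rewrite /= ger0_norm//.
exact: le_lt_trans fm (ltry _).
Qed.

Lemma has_mean_dom f g m : measurable_fun [set: T] f ->
  (forall z, 0 <= f z <= g z) -> has_mean g m ->
  exists2 m', has_mean f m' & m' <= m.
Proof.
move=> mf fg [gi gm]; apply: has_mean_bounded => //.
  by move=> z; case/andP: (fg z).
rewrite -gm; apply: ge0_le_integral => //.
- by move=> z _; rewrite lee_fin; case/andP: (fg z).
- exact/measurable_EFinP.
- by case/integrableP: gi.
- by move=> z _; rewrite lee_fin; case/andP: (fg z).
Qed.

End Mean.

Section MeanVector.
Context {R : realType} {d : nat} {disp : measure_display}.
Context {T : measurableType disp}.

Lemma measurable_dotp (u v : T -> borel 'rV[R]_d) :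
  measurable_fun [set: T] u -> measurable_fun [set: T] v ->
  measurable_fun [set: T] (fun z => dotp (u z : 'rV[R]_d) (v z)).
Proof.
move=> mu mv; apply: measurable_sum => i.
by apply: measurable_funM; exact: measurable_coord.
Qed.

Lemma measurable_addv (u v : T -> borel 'rV[R]_d) :
  measurable_fun [set: T] u -> measurable_fun [set: T] v ->
  measurable_fun [set: T] (fun z => (u z : 'rV[R]_d) + v z : borel 'rV[R]_d).
Proof.
move=> mu mv; apply: measurable_fun_rV => i.
under eq_fun do rewrite mxE.
by apply: measurable_funD; exact: measurable_coord.
Qed.

Lemma measurable_scalev a (u : T -> borel 'rV[R]_d) :
  measurable_fun [set: T] u ->
  measurable_fun [set: T] (fun z => a *: (u z : 'rV[R]_d) : borel 'rV[R]_d).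
Proof.
move=> mu; apply: measurable_fun_rV => i.
under eq_fun do rewrite mxE.
by apply: measurable_funM => //; exact: measurable_coord.
Qed.

Lemma measurable_subv (u v : T -> borel 'rV[R]_d) :
  measurable_fun [set: T] u -> measurable_fun [set: T] v ->
  measurable_fun [set: T] (fun z => (u z : 'rV[R]_d) - v z : borel 'rV[R]_d).
Proof.
move=> mu /(measurable_scalev (-1)) mv.
have := measurable_addv mu mv; congr measurable_fun.
by apply/funext => z; rewrite scaleN1r.
Qed.

Variable mu : probability T R.

Lemma has_mean_dotp (g : T -> 'rV[R]_d) m v : has_integral mu g m ->
  has_mean mu (fun z => dotp (g z) v) (dotp m v).
Proof.
move=> hg; apply: has_mean_sum => i.
rewrite mulrC; have := has_meanZ (v ord0 i) (hg i); congr has_mean.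
by apply/funext => z; rewrite mulrC.
Qed.

Lemma has_integral_measurable (g : T -> 'rV[R]_d) m : has_integral mu g m ->
  measurable_fun [set: T] (g : T -> borel 'rV[R]_d).
Proof.
move=> hg; apply: measurable_fun_rV => i; have [+ _] := hg i.
by move/integrableP => [/measurable_EFinP].
Qed.

End MeanVector.

(** * Second moments of the gradient oracles *)

Section Oracle.
Context {R : realType} {d : nat}.
Implicit Types (f : 'rV[R]_d -> R).

Lemma dotpD_le (u v : 'rV[R]_d) :
  dotp (u + v) (u + v) <= 2 * dotp u u + 2 * dotp v v.
Proof.
have := dotp_ge0 (u - v); rewrite !dotpE (dotpC v u); lra.
Qed.

Lemma grad_lipschitzW (L L' : R) f : L <= L' ->
  grad_lipschitz L f -> grad_lipschitz L' f.
Proof.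
by move=> LL' hL x y; apply: le_trans (hL x y) _; rewrite ler_wpM2r// enorm_ge0.
Qed.

(** The common content of the two sampling assumptions; [m] is the minimum of
    [f]. *)
Definition growth_oracle {disp} {T : measurableType disp} (mu : probability T R)
    (A B : R) f (m : R) (H : 'rV[R]_d -> T -> 'rV[R]_d) : Prop :=
  [/\ tangent_convex f, forall x, has_integral mu (H x) (grad f x) &
    forall x, exists2 s, has_mean mu (fun z => dotp (H x z) (H x z)) s &
      s <= A * (f x - m) + B].

Variables (Z : ptopologicalType) (piZ : probability (borel Z) R) (L eta : R).
Hypotheses (L0 : 0 < L) (eta0 : 0 <= eta).
Variables (f : 'rV[R]_d -> R) (H : 'rV[R]_d -> Z -> 'rV[R]_d).
Hypotheses (hf : is_C1 f) (hL : grad_lipschitz L f).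
Variable (xs : 'rV[R]_d).
Hypothesis hxs : forall x, f xs <= f x.

(** The second moment is at most twice the variance plus twice [|grad f x|^2],
    and the latter is controlled by the gap. *)
Lemma bounded_variance_growth : bounded_variance_oracle piZ eta f H ->
  exists2 B, 0 <= B & growth_oracle piZ (8 * L) B f (f xs) H.
Proof.
case=> hint hvar hcvx.
have tf : tangent_convex f by move=> x y; apply: convex_tangent => //; case: hf.
exists (2 * eta); first by rewrite mulr_ge0.
split=> // x.
have mHx := has_integral_measurable (hint x).
have [v hv vle] : exists2 v,
    has_mean piZ (fun z => dotp (H x z - grad f x) (H x z - grad f x)) v &
    v <= eta.
  apply: has_mean_bounded.
  - by apply: measurable_dotp; apply: measurable_subv => //; exact: measurable_cst.
  - by move=> z; exact: dotp_ge0.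
  - have := hvar x; under eq_integral do rewrite enorm_sqE; exact.
have hb := has_meanD (has_meanZ 2 hv)
  (has_mean_cst piZ (2 * dotp (grad f x) (grad f x))).
have [s hs sle] : exists2 s, has_mean piZ (fun z => dotp (H x z) (H x z)) s &
    s <= 2 * v + 2 * dotp (grad f x) (grad f x).
  apply: has_mean_dom hb; first exact: measurable_dotp.
  move=> z; rewrite dotp_ge0 /=.
  by have := dotpD_le (H x z - grad f x) (grad f x); rewrite subrK.
exists s => //; have := grad_le_gap x L0 hL tf hxs; lra.
Qed.

(** Compare the sample gradients at [x] and at the minimizer [xs].  The squared
    difference is controlled by the Bregman divergence of the sample function,
    and the mean of the divergence is the gap of [f] because [grad f xs = 0].
    At [xs] itself the second moment is finite, by comparison with [xbar]. *)
Lemma convex_sample_growth : convex_sample_oracle piZ L eta f H ->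
  exists2 B, 0 <= B & growth_oracle piZ (8 * L) B f (f xs) H.
Proof.
move=> [ft [_ [[hC1 hmean hgrad [xbar hbar] hcvx] HE]]].
have tft z : tangent_convex (ft^~ z).
  by move=> x y; apply: convex_tangent => //; case: (hC1 z) => -[].
have hLz z : grad_lipschitz L (ft^~ z) by case: (hC1 z).
have hft x : has_mean piZ (ft x) (f x) by exact: hmean.
have tf : tangent_convex f.
  move=> x y; apply: has_mean_le (hft y) _.
    exact: has_meanD (hft x) (has_mean_dotp (y - x) (hgrad x)).
  by move=> z; exact: tft.
have hH x : has_integral piZ (H x) (grad f x).
  have -> : H x = (fun z => grad (ft^~ z) x) by apply/funext => z.
  by apply: hgrad.
have mH x := has_integral_measurable (hH x).
have gs : grad f xs = 0 by exact: (grad_min L0 hL tf hxs).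
have [b0 hb0 b0le] : exists2 v,
    has_mean piZ (fun z => dotp (H xbar z) (H xbar z)) v & v <= eta.
  apply: has_mean_bounded.
  - exact: measurable_dotp.
  - by move=> z; exact: dotp_ge0.
  - move: hbar; under eq_integral do rewrite enorm_sqE -HE; exact.
set q := L ^+ 2 * dotp (xs - xbar) (xs - xbar).
have [b1 hb1 b1le] : exists2 v,
    has_mean piZ (fun z => dotp (H xs z) (H xs z)) v &
    v <= 2 * q + 2 * b0.
  apply: has_mean_dom (has_meanD (has_mean_cst piZ (2 * q)) (has_meanZ 2 hb0)).
    exact: measurable_dotp.
  move=> z; rewrite dotp_ge0 /=.
  have := dotpD_le (H xs z - H xbar z) (H xbar z); rewrite subrK.
  have := grad_lipschitz_sq xs xbar (ltW L0) (hLz z); rewrite -!HE -/q; lra.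
have q0 : 0 <= q by rewrite mulr_ge0 ?sqr_ge0 ?dotp_ge0.
exists (2 * (2 * q + 2 * eta)); first by rewrite mulr_ge0// addr_ge0// mulr_ge0.
split=> // x.
have hbreg : has_mean piZ
    (fun z => ft x z - ft xs z - dotp (grad (ft^~ z) xs) (x - xs)) (f x - f xs).
  have := has_meanB (has_meanB (hft x) (hft xs))
    (has_mean_dotp (x - xs) (hgrad xs)).
  have -> : dotp (grad f xs) (x - xs) = 0.
    by rewrite gs -(scale0r 0) dotpZl mul0r.
  by rewrite subr0.
have [s hs sle] : exists2 s, has_mean piZ (fun z => dotp (H x z) (H x z)) s &
    s <= 2 * (4 * L * (f x - f xs)) + 2 * b1.
  apply: has_mean_dom
    (has_meanD (has_meanZ 2 (has_meanZ (4 * L) hbreg)) (has_meanZ 2 hb1)).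
    exact: measurable_dotp.
  move=> z; rewrite dotp_ge0 /=.
  have := dotpD_le (H x z - H xs z) (H xs z); rewrite subrK.
  have := @grad_diff_le_bregman _ _ _ _ x xs L0 (hLz z) (tft z).
  by rewrite -!HE; lra.
exists s => //; lra.
Qed.

End Oracle.

Section ExpectedStep.
Context {R : realType} {d : nat} {disp : measure_display}.
Context {T : measurableType disp} (mu : probability T R).

Lemma expected_step (x y m : 'rV[R]_d) (h : T -> 'rV[R]_d) (g s : R) :
  has_integral mu h m -> has_mean mu (fun z => dotp (h z) (h z)) s ->
  has_mean mu (fun z => dotp (x - g *: h z - y) (x - g *: h z - y))
    (dotp (x - y) (x - y) + (- (2 * g)) * dotp m (x - y) + g ^+ 2 * s).
Proof.
move=> hm hs.
have := has_meanD (has_meanD (has_mean_cst mu (dotp (x - y) (x - y)))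
  (has_meanZ (- (2 * g)) (has_mean_dotp (x - y) hm))) (has_meanZ (g ^+ 2) hs).
congr has_mean; apply/funext => z.
have -> : x - g *: h z - y = (x - y) - g *: h z by rewrite addrAC.
move: (x - y) => v; rewrite !dotpE (dotpC v (h z)); ring.
Qed.

End ExpectedStep.

(** * The stochastic gradient iterates *)

Section Iterates.
Context {R : realType} {d : nat} {disp dO : measure_display}.
Context {T : measurableType disp} (mu : probability T R).
Context {Omega : measurableType dO} {P : probability Omega R}.
Variables (f : 'rV[R]_d -> R) (xs : 'rV[R]_d) (H : 'rV[R]_d -> T -> 'rV[R]_d).
Variables (L A B : R) (g : nat -> R).
Hypotheses (L0 : 0 < L) (hL : grad_lipschitz L f) (cf : continuous f).
Hypothesis hxs : forall x, f xs <= f x.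
Hypothesis hH : growth_oracle mu A B f (f xs) H.
Hypothesis mH : measurable_fun [set: borel 'rV[R]_d * T]
  (fun p : borel 'rV[R]_d * T => H p.1 p.2 : borel 'rV[R]_d).
Hypothesis (g0 : forall n, 0 < g n).
Variable (Zs : nat -> {RV P >-> T}).
Hypothesis hind : mutually_independent Zs.
Hypothesis hlaw : forall (n : nat) (C : set T), measurable C ->
  distribution P (Zs n) C = mu C.
Variables (X0 : 'rV[R]_d) (X : nat -> Omega -> 'rV[R]_d).
Hypothesis hX0 : forall w, X 0%N w = X0.
Hypothesis hX : forall n w,
  X n.+1 w = X n w - g n *: H (X n w) (Zs n.+1 w).

Local Notation past n := (g_sigma_algebraType (past_cylinders Zs n)).
Local Notation vec := (borel 'rV[R]_d).

Lemma measurable_update {dU} {U : measurableType dU}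
    (x : U -> vec) (z : U -> T) a :
  measurable_fun [set: U] x -> measurable_fun [set: U] z ->
  measurable_fun [set: U] (fun u => (x u : 'rV[R]_d) - a *: H (x u) (z u) : vec).
Proof.
move=> mx mz; apply: measurable_subv => //; apply: measurable_scalev.
have := measurableT_comp mH (measurable_fun_pair mx mz); exact.
Qed.

Lemma iterate_measurable n : measurable_fun [set: past n] (X n : past n -> vec).
Proof.
elim: n => [|n IH].
  have -> : X 0%N = cst X0 by apply/funext => w; exact: hX0.
  exact: measurable_cst.
have -> : X n.+1 = fun w => X n w - g n *: H (X n w) (Zs n.+1 w).
  by apply/funext => w; exact: hX.
apply: (@measurable_update _ (past n.+1)).
  by apply: measurable_fun_past_mono IH; exact: leqnSn.
exact: measurable_past_idx.
Qed.

(** Integrate the next sample out.  The inner integral is at most [bound],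
    thanks to the tangent inequality of [f] between [X n] and [Y] and to the
    growth of the second moment.  The function [bound] has a subtracted term but
    stays nonnegative, since it dominates a nonnegative integral. *)
Lemma iterate_step n (Y : Omega -> 'rV[R]_d) a b c :
  measurable_fun [set: past n] (Y : past n -> vec) ->
  has_mean P (fun w => dotp (X n w - Y w) (X n w - Y w)) a ->
  has_mean P (fun w => f (X n w) - f xs) b ->
  has_mean P (fun w => f (Y w) - f xs) c ->
  exists2 a', has_mean P (fun w => dotp (X n.+1 w - Y w) (X n.+1 w - Y w)) a' &
    a' + 2 * g n * b <= a + 2 * g n * c + g n ^+ 2 * (A * b + B).
Proof.
move=> mY ha hb hc; have [tf hm hs] := hH.
pose phi (p : past n * T) :=
  dotp (X n p.1 - g n *: H (X n p.1) p.2 - Y p.1)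
       (X n p.1 - g n *: H (X n p.1) p.2 - Y p.1).
pose bound w := dotp (X n w - Y w) (X n w - Y w) +
  (2 * g n) * (f (Y w) - f xs) +
  (- (2 * g n)) * (f (X n w) - f xs) + g n ^+ 2 * (A * (f (X n w) - f xs) + B).
have hbound : has_mean P bound
    (a + (2 * g n) * c + (- (2 * g n)) * b + g n ^+ 2 * (A * b + B)).
  exact: has_meanD (has_meanD (has_meanD ha (has_meanZ (2 * g n) hc))
    (has_meanZ (- (2 * g n)) hb)) (has_meanZ (g n ^+ 2)
      (has_meanD (has_meanZ A hb) (has_mean_cst P B))).
have mphi : measurable_fun [set: past n * T] phi.
  have mX1 : measurable_fun [set: past n * T] (fun p : past n * T => X n p.1 : vec).
    exact: (measurableT_comp (@iterate_measurable n) measurable_fst).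
  have mY1 : measurable_fun [set: past n * T] (fun p : past n * T => Y p.1 : vec).
    exact: (measurableT_comp mY measurable_fst).
  by apply: measurable_dotp; apply: measurable_subv => //; apply: measurable_update.
have inner w : (\int[mu]_z (phi (w, z))%:E <= (bound w)%:E)%E.
  have [s hs1 hs2] := hs (X n w).
  have [_ ->] := expected_step (X n w) (Y w) (g n) (hm (X n w)) hs1.
  rewrite lee_fin /bound.
  have := tf (X n w) (Y w).
  have -> : Y w - X n w = - (X n w - Y w) by rewrite opprB.
  rewrite dotpNr => tfw.
  have h1 : 2 * g n * (f (X n w) - dotp (grad f (X n w)) (X n w - Y w)) <=
    2 * g n * f (Y w) by rewrite ler_pM2l ?mulr_gt0.
  have h2 : g n ^+ 2 * s <= g n ^+ 2 * (A * (f (X n w) - f xs) + B).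
    by rewrite ler_pM2l ?exprn_gt0.
  lra.
have E : (\int[P]_w (dotp (X n.+1 w - Y w) (X n.+1 w - Y w))%:E =
          \int[P]_w \int[mu]_z (phi (w, z))%:E)%E.
  rewrite -(integral_past_next hind (n := n) (fun C => @hlaw n.+1 C)
    (phi := EFin \o phi)) //.
  - by apply: eq_integral => w _; rewrite hX.
  - exact/measurable_EFinP.
  - by move=> p; rewrite lee_fin dotp_ge0.
have bound0 w : (0 <= (bound w)%:E)%E.
  apply: le_trans (inner w); apply: integral_ge0 => z _.
  by rewrite lee_fin dotp_ge0.
have mX2 : measurable_fun [set: Omega] (X n.+1 : Omega -> vec).
  exact: measurable_fun_past (@iterate_measurable n.+1).
have mY2 : measurable_fun [set: Omega] (Y : Omega -> vec).
  exact: measurable_fun_past mY.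
have [a' ha' a'le] : exists2 a',
    has_mean P (fun w => dotp (X n.+1 w - Y w) (X n.+1 w - Y w)) a' &
    a' <= a + (2 * g n) * c + (- (2 * g n)) * b + g n ^+ 2 * (A * b + B).
  apply: has_mean_bounded.
  - by apply: measurable_dotp; exact: measurable_subv.
  - by move=> w; exact: dotp_ge0.
  - have [/integrableP[mb _] <-] := hbound.
    rewrite E; apply: ge0_le_integral => //.
    + by move=> w _; apply: integral_ge0 => z _; rewrite lee_fin dotp_ge0.
    + apply: (@measurable_fun_past _ _ _ _ _ _ Zs _ _ n).
      apply: (@measurable_fun_fubini_tonelli_F _ _ _ _ _ mu (EFin \o phi)).
      * exact/measurable_EFinP.
      * by move=> p; rewrite lee_fin dotp_ge0.
exists a' => //; lra.
Qed.

Lemma gap_le_sqdist x : f x - f xs <= L * dotp (x - xs) (x - xs).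
Proof.
have [tf _ _] := hH.
have := descent xs x L0 hL tf.
have -> : dotp (grad f xs) (x - xs) = 0.
  by rewrite (grad_min L0 hL tf hxs) -(scale0r 0) dotpZl mul0r.
lra.
Qed.

Lemma has_mean_gap n a :
  has_mean P (fun w => dotp (X n w - xs) (X n w - xs)) a ->
  exists b, has_mean P (fun w => f (X n w) - f xs) b.
Proof.
move=> ha.
have mX := measurable_fun_past (@iterate_measurable n).
have [b hb _] : exists2 b,
    has_mean P (fun w => f (X n w) - f xs) b & b <= L * a.
  apply: has_mean_dom (has_meanZ L ha).
    apply: measurable_funB => //.
    exact: (measurableT_comp (measurable_continuous cf) mX).
  by move=> w; rewrite subr_ge0 hxs gap_le_sqdist.
by exists b.
Qed.

(** Each step preserves square integrability, since the gap is at most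
    quadratic ([gap_le_sqdist]). *)
Lemma has_mean_sqdist n :
  exists a, has_mean P (fun w => dotp (X n w - xs) (X n w - xs)) a.
Proof.
elim: n => [|n [a ha]].
  exists (dotp (X0 - xs) (X0 - xs)).
  by under eq_fun do rewrite hX0; exact: has_mean_cst.
have [b hb] := has_mean_gap ha.
have h0 : has_mean P (fun w => f xs - f xs) 0.
  by rewrite subrr; exact: has_mean_cst.
have [a' ha' _] := iterate_step (Y := fun=> xs) (measurable_cst _) ha hb h0.
by exists a'.
Qed.

Lemma has_mean_pairdist n k : exists a,
  has_mean P (fun w => dotp (X n w - X k w) (X n w - X k w)) a.
Proof.
have [a ha] := has_mean_sqdist n; have [b hb] := has_mean_sqdist k.
have mX j := measurable_fun_past (@iterate_measurable j).
have [c hc _] : exists2 c,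
    has_mean P (fun w => dotp (X n w - X k w) (X n w - X k w)) c &
    c <= 2 * a + 2 * b.
  apply: has_mean_dom (has_meanD (has_meanZ 2 ha) (has_meanZ 2 hb)).
    by apply: measurable_dotp; apply: measurable_subv; exact: mX.
  move=> w; rewrite dotp_ge0 /=.
  have := dotpD_le (X n w - xs) (- (X k w - xs)).
  rewrite (dotpNl (X k w - xs)) (dotpNr (X k w - xs)) opprK.
  have -> // : X n w - xs - (X k w - xs) = X n w - X k w.
  by rewrite opprB addrA subrK.
by exists c.
Qed.

Lemma gap_rate (gamma alpha : R) :
  0 < gamma -> 0 < alpha < 1 -> 0 < A -> 0 <= B ->
  (forall n, g n = gamma * n.+1%:R `^ (- alpha)) ->
  exists2 C, 0 <= C & forall N, exists2 b,
    has_mean P (fun w => f (X N w) - f xs) b &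
    b <= C * ((1 + ln N.+1%:R) ^+ 2 / N.+1%:R `^ Num.min alpha (1 - alpha)).
Proof.
move=> hgamma halpha A0 B0 gE.
have [D hD] := choice has_mean_sqdist.
have [F hF] := choice (fun n => has_mean_gap (hD n)).
have [Q hQ] := choice (fun p : nat * nat => has_mean_pairdist p.1 p.2).
have hF0 n : 0 <= F n by apply: has_mean_ge0 (hF n) _ => w; rewrite subr_ge0.
have [C C0 hC] : exists2 C, 0 <= C & forall N,
    F N <= C * ((1 + ln N.+1%:R) ^+ 2 / N.+1%:R `^ Num.min alpha (1 - alpha)).
  apply: (last_iterate_rate hgamma halpha A0 B0
    (D := D) (Q := fun n k => Q (n, k))) => //.
  - by move=> n; apply: has_mean_ge0 (hD n) _ => w; exact: dotp_ge0.
  - by move=> n k; apply: has_mean_ge0 (hQ (n, k)) _ => w; exact: dotp_ge0.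
  - move=> k; apply: has_mean_unique (hQ (k, k)) _ => /=.
    under eq_fun do rewrite subrr -(scale0r 0) dotpZl mul0r.
    exact: has_mean_cst.
  - move=> n; rewrite -gE.
    have h0 : has_mean P (fun w => f xs - f xs) 0.
      by rewrite subrr; exact: has_mean_cst.
    have [a' ha'] :=
      iterate_step (Y := fun=> xs) (measurable_cst _) (hD n) (hF n) h0.
    by rewrite (has_mean_unique ha' (hD n.+1)) mulr0 addr0.
  - move=> k n kn; rewrite -gE.
    have mXk : measurable_fun [set: past n] (X k : past n -> vec).
      exact: measurable_fun_past_mono kn (@iterate_measurable k).
    have [a' ha'] := iterate_step mXk (hQ (n, k)) (hF n) (hF k).
    by rewrite (has_mean_unique ha' (hQ (n.+1, k))).
by exists C => // N; exists (F N).
Qed.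

End Iterates.

(** * The rate for the gradient *)

Lemma convex_sample_oracleW (R : realType) (d : nat) (Z : ptopologicalType)
    (piZ : probability (borel Z) R) (L L' eta : R) (f : 'rV[R]_d -> R)
    (H : 'rV[R]_d -> Z -> 'rV[R]_d) : L <= L' ->
  convex_sample_oracle piZ L eta f H -> convex_sample_oracle piZ L' eta f H.
Proof.
move=> LL' [ft [mft [[hC1 hmean hgrad hbar hcvx] HE]]].
exists ft; split=> //; split=> //; split=> // z.
by have [? hL] := hC1 z; split=> //; exact: grad_lipschitzW hL.
Qed.

Unset Implicit Arguments.

Theorem corollary9 (R : realType) (d : nat)
  (f : 'rV[R]_d -> R) (hf : is_C1 f)
  (L : R) (hL : 0 <= L) (hA1 : grad_lipschitz L f)
  (hmin : exists xstar, forall x, f xstar <= f x)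
  (Z : ptopologicalType) (hZ : polish_space R Z)
  (piZ : probability (borel Z) R)
  (eta : R) (heta : 0 <= eta)
  (H : 'rV[R]_d -> Z -> 'rV[R]_d)
  (mH : measurable_fun [set: borel 'rV[R]_d * borel Z]
     (fun p : borel 'rV[R]_d * borel Z => H p.1 p.2 : borel 'rV[R]_d))
  (hF2 : bounded_variance_oracle piZ eta f H \/
         convex_sample_oracle piZ L eta f H)
  (gamma alpha : R) (hgamma : 0 < gamma < 1) (halpha : 0 < alpha < 1)
  (dO : measure_display) (Omega : measurableType dO)
  (P : probability Omega R)
  (Zs : nat -> {RV P >-> borel Z})
  (hind : mutually_independent Zs)
  (hlaw : forall (n : nat) (A : set (borel Z)), measurable A ->
     distribution P (Zs n) A = piZ A)
  (X0 : 'rV[R]_d) (X : nat -> Omega -> 'rV[R]_d)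
  (hX0 : forall w, X 0%N w = X0)
  (hX : forall (n : nat) w,
     X n.+1 w = X n w
       - (gamma * (n.+1%:R `^ (- alpha))) *: H (X n w) (Zs n.+1 w)) :
  exists2 C : R, 0 <= C &
    forall N : nat, (1 <= N)%N ->
      ('E_P[(fun w => enorm (grad f (X N w)) ^+ 2)%R] <=
        (C * ((1 + ln (N.+1%:R)) ^+ 2
              / (N.+1%:R `^ (Num.min alpha (1 - alpha)))))%:E)%E.
Proof.
have [xs hxs] := hmin.
(* The gradient steps of length 1/(2L') ask for a positive constant. *)
pose L' := L + 1.
have LL' : L <= L' by rewrite lerDl.
have L'0 : 0 < L' by rewrite ltr_wpDl.
have hL' : grad_lipschitz L' f by exact: grad_lipschitzW hA1.
have cf : continuous f by move=> x; apply: differentiable_continuous; case: hf.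
have [B B0 hB] : exists2 B, 0 <= B & growth_oracle piZ (8 * L') B f (f xs) H.
  case: hF2 => hF.
    exact: (bounded_variance_growth L'0 heta hf hL' hxs hF).
  exact: (convex_sample_growth L'0 heta hL' hxs (convex_sample_oracleW LL' hF)).
have [gamma0 _] := andP hgamma.
have tf : tangent_convex f by case: hB.
have [C C0 hC] := @gap_rate R d _ _ _ piZ _ P f xs H L' (8 * L') B
  (fun n => gamma * n.+1%:R `^ (- alpha)) L'0 hL' cf hxs hB mH
  (fun n => step_gt0 alpha gamma0 n) Zs hind (fun n C mC => hlaw n C mC)
  X0 X hX0 hX gamma alpha gamma0 halpha (mulr_gt0 (ltr0n _ 8) L'0) B0 (fun=> erefl).
exists (4 * L' * C); first by rewrite !mulr_ge0// ltW.
move=> N _; have [b hb bC] := hC N.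
have [_ Eb] := has_meanZ (4 * L') hb.
rewrite unlock.
apply: (@le_trans _ _ (\int[P]_w (4 * L' * (f (X N w) - f xs))%:E)%E).
  have mX : measurable_fun [set: Omega] (X N : Omega -> borel 'rV[R]_d).
    exact: (measurable_fun_past (P := P)
      (iterate_measurable (P := P) mH hX0 hX (n := N))).
  have mgrad : measurable_fun [set: borel 'rV[R]_d]
      (grad f : borel 'rV[R]_d -> borel 'rV[R]_d).
    apply: measurable_fun_rV => i.
    apply: (measurable_continuous (h := fun x => grad f x ord0 i)) => x.
    by apply: (@continuous_comp _ _ _ (grad f) (fun v => v ord0 i));
      [case: hf => _ /(_ x)|exact: coord_continuous].
  apply: ge0_le_integral => //.
  - by move=> w _; rewrite lee_fin sqr_ge0.
  - apply/measurable_EFinP; under eq_fun do rewrite enorm_sqE.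
    by apply: measurable_dotp; apply: (measurableT_comp mgrad mX).
  - apply/measurable_EFinP; apply: measurable_funM => //.
    apply: measurable_funB => //.
    exact: (measurableT_comp (measurable_continuous cf) mX).
  - by move=> w _; rewrite lee_fin enorm_sqE; exact: grad_le_gap.
by rewrite Eb lee_fin -[leRHS]mulrA ler_wpM2l// mulr_ge0// ltW.
Qed.
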